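(* Let $F$ be a field of characteristic zero. For every $\alpha\in F\setminus\{0\}$, the algebra with trace $D_2^{t_{\alpha,0}}$ generates a variety of almost polynomial growth.
   Context: $F$ is a field of characteristic 0. An algebra with trace is a unitary associative $F$-algebra $A$ with an $F$-linear map $\mathrm{tr}:A\to F$ such that $\mathrm{tr}(ab)=\mathrm{tr}(ba)$; a scalar is identified with the corresponding multiple of $1_A$. The free algebra with trace $F\langle X,\mathrm{Tr}\rangle\cong F\langle X\rangle\otimes F[\mathrm{Tr}(M)]$ on $X=\{x_1,x_2,\dots\}$ is generated by the free unitary associative algebra $F\langle X\rangle$ and central commuting indeterminates $\mathrm{Tr}(M)$, $M$ a nonempty word in $X$, subject to $\mathrm{Tr}(MN)=\mathrm{Tr}(NM)$ and $\mathrm{Tr}(\mathrm{Tr}(M)N)=\mathrm{Tr}(M)\mathrm{Tr}(N)$. An element is a trace identity of $A$ if it becomes $0$ whenever the variables are replaced by arbitrary elements of $A$ and $\mathrm{Tr}$ by $\mathrm{tr}$; $\mathrm{Id}^{tr}(A)$ is the set of trace identities of $A$. $MT_n$ is the space of multilinear elements of $F\langle X,\mathrm{Tr}\rangle$ in $x_1,\dots,x_n$ (the span of all products of traces of words times a word in which each of $x_1,\dots,x_n$ occurs exactly once in total), and $c_n^{tr}(A)=\dim_F MT_n/(MT_n\cap \mathrm{Id}^{tr}(A))$. The variety $\mathrm{var}^{tr}(A)$ is the class of all algebras with trace satisfying all trace identities of $A$. The growth of a variety is the growth of the sequence $c_n^{tr}(A)$ for any algebra with trace $A$ generating it: polynomial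 growth means bounded above by a polynomial in $n$, exponential growth means $c_n^{tr}(A)\ge C b^n$ for all $n\geq 1$, for some $C>0$, $b>1$. A variety has almost polynomial growth if it grows exponentially but every proper subvariety $\mathrm{var}^{tr}(A)$ of it has polynomial growth. $D_2$ is the algebra of $2\times 2$ diagonal matrices over $F$, and $D_2^{t_{\alpha,0}}$ is $D_2$ with the trace $t_{\alpha,0}(\mathrm{diag}(a,b))=\alpha a$. *)

(* Defs.v *)
From HB Require Import structures.
From mathcomp Require Import all_boot all_order all_algebra generic_quotient.
From mathcomp Require Import finmap monalg.
From mathcomp Require Import boolp classical_sets reals.

Set Implicit Arguments.
Unset Strict Implicit.
Unset Printing Implicit Defensive.

Import GRing.Theory Num.Theory.

Local Open Scope classical_set_scope.
Local Open Scope ring_scope.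

(* MathComp's [algType] is unitary, associative, and requires 1 != 0. *)
Record trAlg (F : fieldType) : Type := TrAlg {
  tr_alg :> algType F;
  tr : {scalar tr_alg};
  trC : forall a b : tr_alg, tr (a * b) = tr (b * a)
}.

Arguments tr {F} t.

(* The variables are indexed from 0: the index i : nat stands for x_{i+1}. *)

Record nword : predArgType := NWord {
  nword_val :> seq nat;
  nword_neq0 : nword_val != [::]
}.

HB.instance Definition _ := [isSub for nword_val].
HB.instance Definition _ := [Choice of nword by <:].

(* [rot i u] is NM for the factorization u = MN with |M| = i, so that this is
   the relation Tr(MN) = Tr(NM). *)
Definition cyc_rel (u v : nword) : bool :=
  [exists i : 'I_(size u).+1, val v == rot i (val u)].

Lemma cyc_relP (u v : nword) :
  reflect (exists i, val v = rot i (val u)) (cyc_rel u v).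
Proof.
apply: (iffP existsP) => [[i /eqP->]|[i ->]]; first by exists i.
have [le_iu|lt_ui] := leqP i (size u).
  by exists (Ordinal (le_iu : (i < (size u).+1)%N)).
by exists ord0; rewrite rot0 rot_oversize // ltnW.
Qed.

Lemma cyc_rel_refl : reflexive cyc_rel.
Proof. by move=> u; apply/cyc_relP; exists 0%N; rewrite rot0. Qed.

Lemma cyc_rel_trans : transitive cyc_rel.
Proof.
move=> v u w /cyc_relP[i Ev] /cyc_relP[j Ew]; apply/cyc_relP.
have [le_iu|lt_ui] := leqP i (size u); last first.
  by exists j; rewrite Ew Ev (rot_oversize (ltnW lt_ui)).
have [le_ju|lt_uj] := leqP j (size u); last first.
  by exists i; rewrite Ew Ev rot_oversize // size_rot ltnW.
by rewrite Ew Ev rot_add_mod //; eexists.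
Qed.

Lemma cyc_rel_sym : symmetric cyc_rel.
Proof.
have sym u v : cyc_rel u v -> cyc_rel v u.
  move=> /cyc_relP[i Ev]; apply/cyc_relP; exists (size v - i)%N.
  by rewrite -[LHS](rotK i) -Ev.
by move=> u v; apply/idP/idP; apply: sym.
Qed.

Canonical cyc_equiv := EquivRel cyc_rel cyc_rel_refl cyc_rel_sym cyc_rel_trans.

Definition cycword := {eq_quot cyc_equiv}%qT.
HB.instance Definition _ := Choice.on cycword.
HB.instance Definition _ := Quotient.on cycword.

(* Trace monomials: a commutative monomial in the indeterminates Tr(M), and a
   word in the variables. *)
Definition tmonom : Type := ({cmonom cycword} * {fmonom nat})%type.
HB.instance Definition _ := Choice.on tmonom.

Section TMonom.
Implicit Types x y z : tmonom.

Definition tmone : tmonom := (mone, mone).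
Definition tmmul x y : tmonom := (mmul x.1 y.1, mmul x.2 y.2).

Lemma tmmulA : associative tmmul.
Proof. by move=> x y z; rewrite /tmmul /= !mulmA. Qed.

Lemma tmmul1m : left_id tmone tmmul.
Proof. by case=> x1 x2; rewrite /tmmul /= !mul1m. Qed.

Lemma tmmulm1 : right_id tmone tmmul.
Proof. by case=> x1 x2; rewrite /tmmul /= !mulm1. Qed.

Lemma tmunitm x y : tmmul x y = tmone -> x = tmone /\ y = tmone.
Proof.
case: x y => [x1 x2] [y1 y2] [/unitm[/= -> ->] e2].
by have [-> ->] := unitm _ _ e2.
Qed.

HB.instance Definition _ := Choice_isMonomialDef.Build tmonom
  tmmulA tmmul1m tmmulm1 tmunitm.
End TMonom.

(* F<X,Tr>: the algebra of the product of a free commutative monoid and a free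
   monoid, that is F[Tr(M)] (x) F<X>. *)
Definition freeTr (F : fieldType) : Type := {malg F[tmonom]}.
HB.instance Definition _ (F : fieldType) := GRing.Lalgebra.on (freeTr F).

Section FreeTr.
Variable F : fieldType.

Definition Xvar (i : nat) : freeTr F := << ((mone, fmu i) : tmonom) >>.

Definition Trw (u : nword) : freeTr F :=
  << ((ucm (\pi_cycword u)%qT, mone) : tmonom) >>.

Definition tr_mon (us : seq nword) (w : seq nat) : freeTr F :=
  (\prod_(u <- us) Trw u) * \prod_(i <- w) Xvar i.

Section Evaluation.
Variables (A : trAlg F) (phi : nat -> A).

(* Any representative of the cyclic word does, see [eval_cycE]. *)
Definition eval_cyc (c : cycword) : F :=
  tr A (\prod_(i <- val (repr c : nword)) phi i).

Definition eval_tmonom (m : tmonom) : A :=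
  (\prod_(c <- finsupp m.1) eval_cyc c ^+ m.1 c)
    *: \prod_(i <- (m.2 : seq nat)) phi i.

Definition eval_tr : freeTr F -> A := mmap (in_alg A) eval_tmonom.

Lemma eval_cycE (u : nword) :
  eval_cyc (\pi_cycword u)%qT = tr A (\prod_(i <- val u) phi i).
Proof.
rewrite /eval_cyc; set v := repr _.
have /cyc_relP[i ->] : cyc_rel u v.
  by rewrite -[cyc_rel u v]/(cyc_equiv u v) -eqmodE [X in _ == X]reprK.
by rewrite /rot big_cat /= trC -big_cat cat_take_drop.
Qed.

Lemma eval_tmonom_mmorphism : mmorphism eval_tmonom.
Proof.
split=> [m1 m2|]; last first.
  by rewrite /eval_tmonom /= mdom1 fm1 big_seq_fset0 big_nil scale1r.
rewrite /eval_tmonom -scalerAl -scalerAr scalerA fmM big_cat /=.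
congr (_ *: _).
have extend (m : {cmonom cycword}) (D : {fset cycword}) :
    fsubset (finsupp m) D ->
  \prod_(c <- finsupp m) eval_cyc c ^+ m c = \prod_(c <- D) eval_cyc c ^+ m c.
  move=> mD; apply: (big_fset_incl _ mD) => c _.
  by rewrite -cmE_eq0 => /eqP->.
rewrite (extend m1.1 (finsupp (mmul m1.1 m2.1))) ?mdomD ?fsubsetUl //.
rewrite (extend m2.1 (finsupp (mmul m1.1 m2.1))) ?mdomD ?fsubsetUr //.
rewrite -mdomD -big_split; apply: eq_bigr => c _ /=.
by rewrite cmM exprD.
Qed.

HB.instance Definition _ := isMultiplicative.Build tmonom A eval_tmonom
  eval_tmonom_mmorphism.

Lemma eval_trM (f g : freeTr F) : eval_tr (f * g) = eval_tr f * eval_tr g.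
Proof.
apply: (commr_mmap_is_multiplicative _).1 => h m m'.
by rewrite /GRing.comm /= mulr_algl mulr_algr.
Qed.

Lemma eval_tr1 : eval_tr 1 = 1.
Proof. exact: mmap1. Qed.

Lemma eval_trX (i : nat) : eval_tr (Xvar i) = phi i.
Proof.
rewrite /eval_tr mmapU /= scale1r mul1r /eval_tmonom /= mdom1 big_seq_fset0.
by rewrite scale1r /fmu fmE big_seq1.
Qed.

Lemma eval_trTr (u : nword) :
  eval_tr (Trw u) = (tr A (\prod_(i <- val u) phi i))%:A.
Proof.
rewrite /eval_tr mmapU /= scale1r mul1r /eval_tmonom /= mdomU big_seq_fset1.
by rewrite cmUU expr1 eval_cycE fm1 big_nil.
Qed.

End Evaluation.

Definition tr_identity (A : trAlg F) : set (freeTr F) :=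
  [set f | forall phi : nat -> A, eval_tr phi f = 0].

Definition lin_span (V : lmodType F) (S : set V) : set V :=
  [set f | exists d (a : 'I_d -> F) (e : 'I_d -> V),
     (forall i, S (e i)) /\ f = \sum_i a i *: e i].

Definition multilinear_mon (n : nat) : set (freeTr F) :=
  [set f | exists (us : seq nword) (w : seq nat),
     perm_eq (flatten [seq val u | u <- us] ++ w) (iota 0 n)
     /\ f = tr_mon us w].

Definition MT (n : nat) : set (freeTr F) := lin_span (multilinear_mon n).

(* [quot_dim U I d]: the quotient U / (U `&` I) has a basis of cardinality d. *)
Definition quot_dim (V : lmodType F) (U I : set V) (d : nat) : Prop :=
  exists e : 'I_d -> V,
    [/\ forall i, U (e i),
        forall a : 'I_d -> F, (U `&` I) (\sum_i a i *: e i) ->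
          forall i, a i = 0
      & forall f, U f ->
          exists a : 'I_d -> F, (U `&` I) (f - \sum_i a i *: e i)].

(* The dimension exists and is unique, see [codimP] and [codim_uniq]: the
   default value 0 is never used. *)
Definition codim (A : trAlg F) (n : nat) : nat :=
  xget 0%N [set d | quot_dim (MT n) (tr_identity A) d].

End FreeTr.

Section CodimExists.
Variable F : fieldType.

Lemma quot_dim_exists (V : lmodType F) (S I : set V) (s : seq V) :
    I 0 -> (forall (a : F) f g, I f -> I g -> I (a *: f + g)) ->
    (forall x, S x -> x \in s) ->
  exists d, quot_dim (lin_span S) I d.
Proof.
move=> I0 IL sS.
have ID f g : I f -> I g -> I (f + g).
  by move=> If Ig; rewrite -[f]scale1r; apply: IL.
have IZ (a : F) f : I f -> I (a *: f).
  by move=> If; rewrite -[_ *: _]addr0; apply: IL.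
have [d [e [eS e_free e_gen]]] : exists d (e : 'I_d -> V),
    [/\ forall i, S (e i),
        forall a : 'I_d -> F, I (\sum_i a i *: e i) -> forall i, a i = 0
      & forall x, x \in s -> S x ->
          exists a : 'I_d -> F, I (x - \sum_i a i *: e i)].
  elim: s {sS} => [|x s [d [e [eS e_free e_gen]]]].
    by exists 0%N, (fun=> 0); split=> [[]|a _ []|].
  have [Sx|nSx] := pselect (S x); last first.
    exists d, e; split=> // y; rewrite inE => /predU1P[-> //|ys].
    exact: e_gen.
  have [[a Ia]|ngen] := pselect (exists a : 'I_d -> F,
      I (x - \sum_i a i *: e i)).
    exists d, e; split=> // y; rewrite inE => /predU1P[-> _|]; last exact: e_gen.
    by exists a.
  pose e' (i : 'I_d.+1) := oapp e x (unlift ord0 i).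
  have sumE (a : 'I_d.+1 -> F) : \sum_i a i *: e' i
      = a ord0 *: x + \sum_i a (lift ord0 i) *: e i.
    rewrite big_ord_recl /e' unlift_none /=; congr (_ + _).
    by apply: eq_bigr => i _; rewrite liftK.
  exists d.+1, e'; split=> [i|a|y].
  - by rewrite /e'; case: unliftP => [j|] _ //=.
  - rewrite sumE => Ia.
    have a0 : a ord0 = 0.
      apply/eqP; apply: contra_notT ngen => a0.
      exists (fun i => - (a ord0)^-1 * a (lift ord0 i)).
      have := IZ (a ord0)^-1 _ Ia.
      rewrite scalerDr scalerA mulVf // scale1r scaler_sumr; congr (I (_ + _)).
      rewrite -sumrN; apply: eq_bigr => i _.
      by rewrite scalerA mulNr scaleNr opprK.
    move: Ia; rewrite a0 scale0r add0r => /e_free aE i.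
    by case: (unliftP ord0 i) => [j|] ->.
  - rewrite inE => /predU1P[->|ys] Sy.
      exists (fun i => (i == ord0)%:R); rewrite sumE eqxx scale1r big1 ?addr0.
        by rewrite subrr.
      by move=> i _; rewrite scale0r.
    have [a Ia] := e_gen _ ys Sy.
    exists (fun i => oapp a 0 (unlift ord0 i)).
    rewrite sumE unlift_none scale0r add0r.
    by under eq_bigr do rewrite liftK /=.
have eU (b : 'I_d -> F) : lin_span S (\sum_i b i *: e i) by exists d, b, e.
exists d, e; split=> [i|a [_]|f Uf]; last 1 first.
- have [k [b [x [xS fE]]]] := Uf.
  have /choice[a aP] : forall j, exists a : 'I_d -> F,
      I (x j - \sum_i a i *: e i).
    by move=> j; apply: e_gen; [apply: sS|]; apply: xS.
  pose c i := \sum_j b j * a j i.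
  exists c; split.
    pose coef (i : 'I_(k + d)) :=
      match split i with inl j => b j | inr j => - c j end.
    pose vect (i : 'I_(k + d)) :=
      match split i with inl j => x j | inr j => e j end.
    exists (k + d)%N, coef, vect; split.
      by rewrite /vect => i; case: split.
    rewrite big_split_ord /= fE -sumrN; congr (_ + _); apply: eq_bigr => i _.
      by rewrite /coef /vect (unsplitK (inl _ i)).
    by rewrite /coef /vect (unsplitK (inr _ i)) scaleNr.
  have -> : f - \sum_i c i *: e i = \sum_j b j *: (x j - \sum_i a j i *: e i).
    rewrite fE; under [RHS]eq_bigr do rewrite scalerBr.
    rewrite sumrB; congr (_ - _); under [RHS]eq_bigr do rewrite scaler_sumr.
    rewrite exchange_big; apply: eq_bigr => i _; rewrite scaler_suml.
    by apply: eq_bigr => j _; rewrite scalerA.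
  by apply: (big_ind I) => // j _; apply: IZ.
- by exists 1%N, (fun=> 1), (fun=> e i); rewrite big_ord1 scale1r.
- exact: e_free.
Qed.

Lemma quot_dim_leq (V : lmodType F) (U I : set V) (d1 d2 : nat) :
    (forall d (a : 'I_d -> F) (e : 'I_d -> V), (forall i, U (e i)) ->
       U (\sum_i a i *: e i)) ->
    I 0 -> (forall (a : F) f g, I f -> I g -> I (a *: f + g)) ->
  quot_dim U I d1 -> quot_dim U I d2 -> (d2 <= d1)%N.
Proof.
move=> UL I0 IL [e1 [_ _ gen1]] [e2 [U2 free2 _]].
have ID f g : I f -> I g -> I (f + g).
  by move=> If Ig; rewrite -[f]scale1r; apply: IL.
have IZ (a : F) f : I f -> I (a *: f).
  by move=> If; rewrite -[_ *: _]addr0; apply: IL.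
have /choice[m mP] : forall j, exists a : 'I_d1 -> F,
    I (e2 j - \sum_i a i *: e1 i).
  by move=> j; have [a [_ Ia]] := gen1 _ (U2 j); exists a.
pose M := \matrix_(j < d2, i < d1) m j i.
rewrite -(mxrank1 F d2); have <- : \rank M = \rank (1%:M : 'M[F]_d2).
  rewrite mxrank1; apply/eqP; rewrite -/(row_free M).
  rewrite -kermx_eq0; apply/eqP/row_matrixP => k; rewrite row0.
  set u := row k _; have uM : u *m M = 0.
    by apply/sub_kermxP; rewrite row_sub.
  apply/rowP => j; rewrite [RHS]mxE; apply: (free2 (u 0)).
  split; first exact: UL.
  have <- : \sum_j u 0 j *: (e2 j - \sum_i m j i *: e1 i)
      = \sum_j u 0 j *: e2 j.
    under eq_bigr do rewrite scalerBr; rewrite sumrB [X in _ - X](_ : _ = 0).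
      by rewrite subr0.
    under eq_bigr do rewrite scaler_sumr; rewrite exchange_big big1 // => i _.
    have uMi : \sum_j u 0 j * m j i = 0.
      move/rowP/(_ i): uM; rewrite mxE [RHS]mxE => uM0; rewrite -[RHS]uM0.
      by apply: eq_bigr => l _; rewrite [M _ _]mxE.
    by under eq_bigr do rewrite scalerA; rewrite -scaler_suml uMi scale0r.
  by apply: (big_ind I) => // i _; apply: IZ.
exact: rank_leq_col.
Qed.

Lemma eval_tr_linear (A : trAlg F) (phi : nat -> A) (a : F) (f g : freeTr F) :
  eval_tr phi (a *: f + g) = a *: eval_tr phi f + eval_tr phi g.
Proof.
rewrite /eval_tr mmapD; congr (_ + _).
rewrite (mmapEw (msuppZ_le a f)) mmapE scaler_sumr.
by apply: eq_bigr => m _; rewrite mcoeffZ /= !mulr_algl -scalerA.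
Qed.

Lemma tr_identity0 (A : trAlg F) : tr_identity A 0.
Proof. by move=> phi; rewrite /eval_tr mmap0. Qed.

Lemma tr_identityL (A : trAlg F) (a : F) (f g : freeTr F) :
  tr_identity A f -> tr_identity A g -> tr_identity A (a *: f + g).
Proof.
by move=> If Ig phi; rewrite eval_tr_linear If Ig scaler0 addr0.
Qed.

Lemma multilinear_mon_finite (n : nat) :
  exists s : seq (freeTr F), forall f, multilinear_mon n f -> f \in s.
Proof.
pose dec (l sh : seq nat) : freeTr F :=
  tr_mon F (pmap insub (reshape sh l)) (drop (sumn sh) l).
pose shs := [seq [seq val i | i <- tval t] |
  k <- iota 0 n.+1, t <- enum {: k.-tuple 'I_n.+1}] : seq (seq nat).
exists [seq dec l sh | l : seq nat <- permutations (iota 0 n), sh : seq nat <- shs].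
move=> f [us [w [usw ->]]].
pose sh := [seq size (val u) | u <- us].
have shE : shape [seq val u | u <- us] = sh by rewrite /sh /shape -map_comp.
have le_sh : (sumn sh <= n)%N.
  by rewrite -shE -size_flatten -(size_iota 0 n) -(perm_size usw) size_cat
             leq_addr.
apply/allpairsP; exists (flatten [seq val u | u <- us] ++ w, sh) => /=; split.
- by rewrite mem_permutations.
- have szu : (size us <= sumn sh)%N.
    rewrite /sh; elim: (us) => //= u us' IH.
    by rewrite -add1n leq_add // lt0n size_eq0 nword_neq0.
  have lt_sh : all (fun k => k < n.+1)%N sh.
    apply/allP => k; rewrite ltnS; move: le_sh.
    elim: (sh) => //= x sh' IH le_n; rewrite inE => /predU1P[->|].
      exact: leq_trans (leq_addr _ _) le_n.
    by apply: IH; apply: leq_trans le_n; apply: leq_addl.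
  apply/allpairsPdep; exists (size us).
  have sz : size [seq (inord k : 'I_n.+1) | k <- sh] == size us.
    by rewrite !size_map.
  exists (Tuple sz); split.
  + by rewrite mem_iota add0n ltnS (leq_trans szu).
  + by rewrite mem_enum.
  + rewrite -map_comp -[LHS]map_id; apply/eq_in_map => k k_sh /=.
    by rewrite inordK //; apply: (allP lt_sh).
- rewrite /dec; congr (tr_mon F _ _); last first.
    by rewrite -shE -size_flatten drop_size_cat.
  rewrite /sh; elim: (us) => //= u us' IH.
  rewrite -catA take_size_cat // drop_size_cat // insubT ?nword_neq0 //=.
  by move=> Pu; rewrite -IH; congr (_ :: _); apply: val_inj.
Qed.

Lemma lin_span_sum (V : lmodType F) (S : set V) (d : nat) (a : 'I_d -> F)
    (e : 'I_d -> V) :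
  (forall i, lin_span S (e i)) -> lin_span S (\sum_i a i *: e i).
Proof.
move=> eS; apply: (big_ind (lin_span S)).
- by exists 0%N, (fun=> 0), (fun=> 0); split=> [[]|]; rewrite ?big_ord0.
- move=> _ _ [k1 [b1 [x1 [S1 ->]]]] [k2 [b2 [x2 [S2 ->]]]].
  pose coef (i : 'I_(k1 + k2)) :=
    match split i with inl j => b1 j | inr j => b2 j end.
  pose vect (i : 'I_(k1 + k2)) :=
    match split i with inl j => x1 j | inr j => x2 j end.
  exists (k1 + k2)%N, coef, vect; split.
    by rewrite /vect => i; case: split.
  rewrite big_split_ord /=; congr (_ + _); apply: eq_bigr => i _.
    by rewrite /coef /vect (unsplitK (inl _ i)).
  by rewrite /coef /vect (unsplitK (inr _ i)).
- move=> i _; have [k [b [x [Sx ->]]]] := eS i.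
  exists k, (fun j => a i * b j), x; split=> //.
  by rewrite scaler_sumr; apply: eq_bigr => j _; rewrite scalerA.
Qed.

Lemma codimP (A : trAlg F) (n : nat) :
  quot_dim (MT n) (tr_identity A) (codim A n).
Proof.
have [s sP] := multilinear_mon_finite n.
have [d dP] := quot_dim_exists (@tr_identity0 A) (@tr_identityL A) sP.
exact: (@xgetPex _ 0%N [set d | quot_dim (MT n) (tr_identity A) d] (ex_intro _ d dP)).
Qed.

Lemma codim_uniq (A : trAlg F) (n d : nat) :
  quot_dim (MT n) (tr_identity A) d -> codim A n = d.
Proof.
move=> dP; apply/eqP; rewrite eqn_leq.
have leP d1 d2 := @quot_dim_leq _ (MT n) (tr_identity A) d1 d2
  (@lin_span_sum _ _) (@tr_identity0 A) (@tr_identityL A).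
by rewrite (leP _ _ dP (codimP A n)) (leP _ _ (codimP A n) dP).
Qed.

End CodimExists.

Section Varieties.
Variables (R : realType) (F : fieldType).

(* A variety is a predicate on [trAlg F] and not a [set (trAlg F)], which would
   be universe-inconsistent. *)
Definition var_tr (A : trAlg F) : trAlg F -> Prop :=
  fun B => tr_identity A `<=` tr_identity B.

Definition generates (A : trAlg F) (V : trAlg F -> Prop) : Prop :=
  forall B, V B <-> var_tr A B.

Definition proper_subclass (W V : trAlg F -> Prop) : Prop :=
  (forall B, W B -> V B) /\ (exists B, V B /\ ~ W B).

Definition polynomial_growth (c : nat -> nat) : Prop :=
  exists p : {poly R}, forall n, (0 < n)%N -> (c n)%:R <= p.[n%:R].

Definition exponential_growth (c : nat -> nat) : Prop :=
  exists C b : R, [/\ 0 < C, 1 < b &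
    forall n, (0 < n)%N -> C * b ^+ n <= (c n)%:R].

(* The growth of V does not depend on the algebra A generating V. *)
Definition variety_growth (P : (nat -> nat) -> Prop) (V : trAlg F -> Prop) :
    Prop :=
  forall A : trAlg F, generates A V -> P (codim A).

Definition almost_polynomial_growth (V : trAlg F -> Prop) : Prop :=
  variety_growth exponential_growth V /\
  forall A : trAlg F, proper_subclass (var_tr A) V ->
    variety_growth polynomial_growth (var_tr A).

End Varieties.

Section DiagonalMatrices.
Variable F : fieldType.

Definition diag_pred : {pred 'M[F]_2} := fun M => is_diag_mx M.

Lemma diag_subalg : GRing.subalg_closed diag_pred.
Proof.
split=> [|a M N|M N]; rewrite /in_mem /=.
- exact: scalar_mx_is_diag.
- move=> /is_diag_mxP dM /is_diag_mxP dN; apply/is_diag_mxP => i j ij.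
  by rewrite !mxE dM // dN // mulr0 addr0.
- move=> /is_diag_mxP dM /is_diag_mxP dN; apply/is_diag_mxP => i j ij.
  rewrite !mxE big1 // => k _; have [ik|ik] := eqVneq (i : nat) k.
    by rewrite dN ?mulr0 // -ik.
  by rewrite dM ?mul0r.
Qed.

HB.instance Definition _ := GRing.isSubalgClosed.Build F 'M[F]_2 diag_pred
  diag_subalg.

Record D2 : predArgType := MkD2 {
  D2_mx :> 'M[F]_2;
  D2_diag : D2_mx \in diag_pred
}.

HB.instance Definition _ := [isSub for D2_mx].
HB.instance Definition _ := [Choice of D2 by <:].
HB.instance Definition _ := [SubChoice_isSubAlgebra of D2 by <:].

Variable alpha : F.

Definition t_alpha0 (M : D2) : F := alpha * D2_mx M ord0 ord0.

Lemma t_alpha0_linear : scalar t_alpha0.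
Proof. by move=> a M N; rewrite /t_alpha0 !mxE mulrDr mulrCA. Qed.

HB.instance Definition _ := GRing.isLinear.Build F D2 F *%R t_alpha0
  t_alpha0_linear.

Lemma t_alpha0C (M N : D2) : t_alpha0 (M * N) = t_alpha0 (N * M).
Proof.
have mulE (P Q : D2) : D2_mx (P * Q) ord0 ord0 = P ord0 ord0 * Q ord0 ord0.
  rewrite /= mxE big_ord_recl big_ord1.
  have /is_diag_mxP dP := D2_diag P.
  by rewrite (dP _ (lift ord0 ord0)) // mul0r addr0.
by rewrite /t_alpha0 !mulE [X in _ * X]mulrC.
Qed.

Definition D2_tr : trAlg F := @TrAlg F D2 t_alpha0 t_alpha0C.

End DiagonalMatrices.

(* Main.v *)
From HB Require Import structures.
Require Import Defs.
From mathcomp Require Import all_boot all_order all_algebra.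
From mathcomp Require Import finmap monalg.
From mathcomp Require Import boolp classical_sets reals.

(** Write D for D_2 with the trace t(u, v) = alpha u. It is commutative and
satisfies Tr(x) Tr(y) = alpha Tr(xy); that is, chi = tr / alpha is a
multiplicative linear form. Both facts pass to every algebra A of the variety
of D ([var_D2_mulC], [var_D2_trM]), and on such an A a multilinear monomial
with word part w evaluates to a scalar times the product of the chi(x_i),
i not in w, times the product of the x_i, i in w ([eval_tr_mon_char]).

Exponential growth. For each S in {1..n}, take the monomial with trace part on
S and word part off S. Substituting the idempotent (1, 0) for the variables of
S0 and (0, 1) for the others, and reading the second coordinate, gives a
nonzero value at S = S0 and 0 at every other S. So these 2^n monomials are
independent modulo the identities of D ([leq_codim_D2]).

Proper subvarieties. Let A generate one. Multiplicativity forces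
chi(x) (chi(1) - 1) = 0. If chi(1) <> 1 the trace of A is zero, and the
codimensions are at most 1 ([codim_tr0]). Otherwise chi is a character; let N
be its kernel, and f an identity of A that is not one of D. No
multilinearization of f is needed. Indeed F[T] with the trace
p |-> alpha p(0) is a universal model: for every x in N, the substitution
T |-> x is a morphism F[T] -> A of algebras with trace, and likewise for D,
whose elements are all of the form u + (v - u) e with e = (0, 1) in the kernel.
Thus f takes some nonzero value q in F[T] ([not_identity_D2_poly]), and
q(x) = 0 for all x in N. Replacing x by its scalar multiples separates the
terms of q(x), so that x^k = 0 on N for k the degree of q ([nil_index]). In
characteristic 0 polarization turns this into N^k = 0 ([nil_prod_eq0]).
Finally, expand each x_i as chi(x_i) + (x_i - chi(x_i)): the multilinear
elements become combinations of the products of x_i - chi(x_i), i in S, and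
chi(x_i), i not in S. Those with at least k elements in S vanish, which leaves
polynomially many ([codim_leq_small_sets], [card_small_sets]). *)

Set Implicit Arguments.
Unset Strict Implicit.
Unset Printing Implicit Defensive.

Import GRing.Theory Num.Theory.
Local Open Scope ring_scope.

(** * Linear algebra *)

Section LinearAlgebra.
Variable F : fieldType.

Lemma left_kernel_neq0 (I J : finType) (P : {pred J}) (M : I -> J -> F) :
    (#|P| < #|I|)%N ->
  exists2 u : I -> F, exists i, u i != 0 &
    forall j, j \in P -> \sum_i u i * M i j = 0.
Proof.
move=> ltPI.
pose A := \matrix_(i < #|I|, j < #|P|) M (enum_val i) (enum_val j).
have /rowV0Pn[v vA v0] : kermx A != 0.
  rewrite kermx_eq0 /row_free; apply: contraTneq ltPI => rkA.
  by rewrite -leqNgt -[X in (X <= _)%N]rkA rank_leq_col.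
exists (fun i => v 0 (enum_rank i)).
  have [i vi] : exists i, v 0 i != 0.
    apply/existsP; apply: contraNT v0; rewrite negb_exists => /forallP v0.
    by apply/eqP/rowP => i; rewrite mxE; apply/eqP; have := v0 i; rewrite negbK.
  by exists (enum_val i); rewrite enum_valK.
move=> j jP; have /sub_kermxP/rowP/(_ (enum_rank_in jP j)) := vA.
rewrite !mxE => vA0; rewrite -[RHS]vA0.
rewrite (reindex (@enum_val I predT)) /=; last exact/onW_bij/enum_val_bij.
by apply: eq_bigr => i _; rewrite enum_valK mxE enum_rankK_in.
Qed.

(** Comparing the values at [l] and [2 * l] eliminates the top coefficient, at
the cost of the factors [2 ^+ n - 2 ^+ i], nonzero in characteristic 0. *)
Lemma poly_vanish_coef (V : lmodType F) (n : nat) (w : nat -> V) :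
    [pchar F] =i pred0 ->
    (forall l : F, \sum_(i < n) l ^+ i *: w i = 0) ->
  forall i, (i < n)%N -> w i = 0.
Proof.
move=> /pcharf0P F0; elim: n w => [//|n IHn] w w0.
have wn0 i : (i < n)%N -> w i = 0.
  move=> lt_in; pose c j : F := 2 ^+ n - 2 ^+ j.
  suff: c i *: w i = 0.
    move/eqP; rewrite scaler_eq0 => /orP[|/eqP//].
    rewrite /c -!natrX -natrB ?leq_exp2l ?(ltnW lt_in) // F0 subn_eq0.
    by rewrite leq_exp2l // leqNgt lt_in.
  apply: (IHn (fun j => c j *: w j)) => // l.
  have E : 2 ^+ n *: (\sum_(i < n.+1) l ^+ i *: w i)
      - \sum_(i < n.+1) (2 * l) ^+ i *: w i = 0.
    by rewrite !w0 scaler0 subr0.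
  rewrite -[RHS]E scaler_sumr -sumrB big_ord_recr /=.
  rewrite scalerA -exprMn subrr addr0; apply: eq_bigr => j _.
  by rewrite !scalerA -scalerBl exprMn -mulrBl mulrC.
move=> i; rewrite ltnS leq_eqVlt => /predU1P[->|/wn0//].
have := w0 1; rewrite big_ord_recr /= big1 ?add0r ?expr1n ?scale1r //.
by move=> j _; rewrite wn0 ?scaler0.
Qed.

End LinearAlgebra.

(** * Evaluation of trace polynomials and codimensions *)

Section Evaluation.
Variable F : fieldType.

Lemma eval_trZ (A : trAlg F) (phi : nat -> A) (a : F) (f : freeTr F) :
  eval_tr phi (a *: f) = a *: eval_tr phi f.
Proof. by rewrite -[_ *: f]addr0 eval_tr_linear tr_identity0 addr0. Qed.

Lemma eval_tr_sum (A : trAlg F) (phi : nat -> A) (I : finType) (a : I -> F)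
    (e : I -> freeTr F) :
  eval_tr phi (\sum_i a i *: e i) = \sum_i a i *: eval_tr phi (e i).
Proof.
rewrite (big_morph (eval_tr phi) (id1 := 0) (op1 := +%R)) => [|f g|].
- by apply: eq_bigr => i _; rewrite eval_trZ.
- by rewrite -[f in LHS]scale1r eval_tr_linear scale1r.
- exact: tr_identity0.
Qed.

Lemma eval_trB (A : trAlg F) (phi : nat -> A) (f g : freeTr F) :
  eval_tr phi (f - g) = eval_tr phi f - eval_tr phi g.
Proof. by rewrite addrC -scaleN1r eval_tr_linear scaleN1r addrC. Qed.

(** A morphism of algebras with trace commutes with substitution, so every
value of a trace polynomial can be computed in a model that maps to [A].
Scalability is a separate hypothesis because [horner_alg] is canonically
linear for the scaling through [in_alg] only. *)
Lemma eval_tr_morph (A B : trAlg F) (psi : {rmorphism A -> B})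
    (phi : nat -> A) (f : freeTr F) :
    scalable psi -> (forall a, tr B (psi a) = tr A a) ->
  eval_tr (psi \o phi) f = psi (eval_tr phi f).
Proof.
move=> psiZ psi_tr.
have mE m : eval_tmonom (psi \o phi) m = psi (eval_tmonom phi m).
  rewrite /eval_tmonom psiZ rmorph_prod.
  congr (_ *: _); apply: eq_bigr => c _; congr (_ ^+ _).
  by rewrite /eval_cyc -psi_tr rmorph_prod.
rewrite /eval_tr !mmapE raddf_sum; apply: eq_bigr => m _.
rewrite mE; apply/esym/(etrans (rmorphM psi _ _)); congr (_ * _).
by apply: (etrans (psiZ _ _)); rewrite rmorph1.
Qed.

Lemma eval_tr_mon (A : trAlg F) (phi : nat -> A) us w :
  eval_tr phi (tr_mon F us w) =
  (\prod_(u <- us) tr A (\prod_(i <- val u) phi i)) *: \prod_(i <- w) phi i.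
Proof.
rewrite /tr_mon eval_trM; have prodE I (s : seq I) (G : I -> freeTr F) :
    eval_tr phi (\prod_(i <- s) G i) = \prod_(i <- s) eval_tr phi (G i).
  by apply: (big_morph (eval_tr phi)) => [x y|]; rewrite ?eval_trM ?eval_tr1.
rewrite !prodE; under eq_bigr do rewrite eval_trTr.
under [X in _ * X]eq_bigr do rewrite eval_trX.
by rewrite -(rmorph_prod (in_alg A)) mulr_algl.
Qed.

(** Modulo the identities an element is determined by its evaluation map, so
the dimension can be bounded in the space of all functions of the
substitution, where a spanning family [h] is easy to write. *)
Lemma codim_leq (A : trAlg F) n (J : finType) (P : {pred J})
    (h : J -> (nat -> A) -> A) :
    (forall us w,
       perm_eq (flatten [seq val u | u <- us] ++ w) (iota 0 n) ->
     exists a : J -> F, forall phi : nat -> A,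
       eval_tr phi (tr_mon F us w) = \sum_(j in P) a j *: h j phi) ->
  (codim A n <= #|P|)%N.
Proof.
move=> hP; have [e [eU efree _]] := codimP A n.
have /choice[M eM] : forall i, exists a : J -> F, forall phi : nat -> A,
    eval_tr phi (e i) = \sum_(j in P) a j *: h j phi.
  move=> i; have [d [b [x [xS ->]]]] := eU i.
  have /choice[c cP] : forall k, exists a : J -> F, forall phi : nat -> A,
      eval_tr phi (x k) = \sum_(j in P) a j *: h j phi.
    by move=> k; have [us [w [/hP[a aP] ->]]] := xS k; exists a.
  exists (fun j => \sum_k b k * c k j) => phi; rewrite eval_tr_sum.
  under [RHS]eq_bigr do rewrite scaler_suml.
  rewrite exchange_big; apply: eq_bigr => k _ /=.
  rewrite cP scaler_sumr.
  by apply: eq_bigr => j _; rewrite scalerA.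
rewrite leqNgt; apply/negP; rewrite -[X in (_ < X)%N]card_ord.
move=> /(@left_kernel_neq0 _ _ _ _ M)[u [i /eqP ui] u0]; apply: ui.
apply: efree; split=> [|phi]; first exact: lin_span_sum.
rewrite eval_tr_sum; under eq_bigr do rewrite eM scaler_sumr.
rewrite exchange_big big1 // => j jP; under eq_bigr do rewrite scalerA.
by rewrite -scaler_suml u0 // scale0r.
Qed.

Lemma leq_codim (A : trAlg F) n (J : finType) (g : J -> freeTr F) :
    (forall j, MT n (g j)) ->
    (forall a : J -> F, tr_identity A (\sum_j a j *: g j) ->
       forall j, a j = 0) ->
  (#|J| <= codim A n)%N.
Proof.
move=> gU gfree; have [e [_ _ egen]] := codimP A n.
have /choice[M gM] : forall j, exists a : 'I_(codim A n) -> F,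
    tr_identity A (g j - \sum_i a i *: e i).
  by move=> j; have [a [_ aP]] := egen _ (gU j); exists a.
rewrite leqNgt -[X in (X < _)%N]card_ord; apply/negP.
move=> /(@left_kernel_neq0 _ _ _ _ M)[u [j /eqP uj] u0]; apply: uj.
apply: gfree => phi; rewrite eval_tr_sum.
have gE k : eval_tr phi (g k) = \sum_i M k i *: eval_tr phi (e i).
  by rewrite -eval_tr_sum; apply: subr0_eq; rewrite -eval_trB gM.
under eq_bigr do rewrite gE scaler_sumr.
rewrite exchange_big big1 // => i _; under eq_bigr do rewrite scalerA.
by rewrite -scaler_suml u0 // scale0r.
Qed.

End Evaluation.

(** * The identities of the diagonal algebra *)

Section DefiningIdentities.
Variables (F : fieldType).

Definition commutator : freeTr F := Xvar F 0 * Xvar F 1 - Xvar F 1 * Xvar F 0.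

Lemma eval_commutator (A : trAlg F) (phi : nat -> A) :
  eval_tr phi commutator = phi 0 * phi 1 - phi 1 * phi 0.
Proof.
rewrite eval_trB; congr (_ - _).
  by rewrite eval_trM; congr (_ * _); apply: eval_trX.
by rewrite eval_trM; congr (_ * _); apply: eval_trX.
Qed.

Lemma commutator_identityP (A : trAlg F) :
  tr_identity A commutator <-> forall x y : A, x * y = y * x.
Proof.
split=> [cA x y|cA phi]; last by rewrite eval_commutator cA subrr.
have := cA (fun i => if i == 0%N then x else y).
by rewrite eval_commutator => /subr0_eq.
Qed.

Definition tr_mul_defect (alpha : F) : freeTr F :=
  Trw F (@NWord [:: 0] isT) * Trw F (@NWord [:: 1] isT)
  - alpha *: Trw F (@NWord [:: 0; 1] isT).

Lemma eval_tr_mul_defect alpha (A : trAlg F) (phi : nat -> A) :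
  eval_tr phi (tr_mul_defect alpha) =
  (tr A (phi 0) * tr A (phi 1) - alpha * tr A (phi 0 * phi 1))%:A.
Proof.
rewrite scalerBl eval_trB; congr (_ - _).
  rewrite eval_trM -scalerA -mulr_algl.
  by congr (_ * _); rewrite eval_trTr big_seq1.
rewrite eval_trZ -scalerA; congr (_ *: _).
by rewrite eval_trTr big_cons big_seq1.
Qed.

Lemma tr_mul_identityP alpha (A : trAlg F) :
  tr_identity A (tr_mul_defect alpha) <->
  forall x y : A, tr A x * tr A y = alpha * tr A (x * y).
Proof.
split=> [tA x y|tA phi]; last by rewrite eval_tr_mul_defect tA subrr scale0r.
have := tA (fun i => if i == 0%N then x else y); rewrite eval_tr_mul_defect.
move=> /eqP; rewrite scaler_eq0 => /orP[/eqP/subr0_eq//|].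
by rewrite oner_eq0.
Qed.

End DefiningIdentities.

Section Diagonal.
Variables (F : fieldType) (alpha : F).
Local Notation D := (D2_tr alpha).

Definition diag_coord (i : 'I_2) (x : D2 F) : F := D2_mx x i i.

Lemma diag_coordM i : {morph diag_coord i : x y / x * y}.
Proof.
move=> x y; rewrite /diag_coord /= mxE (bigD1 i) //= big1 ?addr0 // => j ij.
by have /is_diag_mxP-> := D2_diag x; rewrite ?mul0r // eq_sym.
Qed.

Lemma diag_coord1 i : diag_coord i 1 = 1.
Proof. by rewrite /diag_coord /= mxE eqxx. Qed.

Lemma diag_coordB i : {morph diag_coord i : x y / x - y}.
Proof. by move=> x y; rewrite /diag_coord /= !mxE. Qed.

Lemma diag_coordD i : {morph diag_coord i : x y / x + y}.
Proof. by move=> x y; rewrite /diag_coord /= !mxE. Qed.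

Lemma diag_coordZ i a x : diag_coord i (a *: x) = a * diag_coord i x.
Proof. by rewrite /diag_coord /= !mxE. Qed.

Lemma diag_coord_inj (x y : D2 F) : diag_coord^~ x =1 diag_coord^~ y -> x = y.
Proof.
move=> xy; apply/val_inj/matrixP => i j; have [->|ij] := eqVneq i j.
  exact: xy.
have /is_diag_mxP-> := D2_diag x; last by [].
by have /is_diag_mxP-> := D2_diag y.
Qed.

Lemma diag_coord_prod i (I : Type) (s : seq I) (f : I -> D2 F) :
  diag_coord i (\prod_(j <- s) f j) = \prod_(j <- s) diag_coord i (f j).
Proof. exact: (big_morph _ (diag_coordM i) (diag_coord1 i)). Qed.

Lemma diag_mulC (x y : D2 F) : x * y = y * x.
Proof. by apply: diag_coord_inj => i; rewrite !diag_coordM mulrC. Qed.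

Lemma diag_trM (x y : D) : tr D x * tr D y = alpha * tr D (x * y).
Proof.
rewrite -[tr D x]/(alpha * diag_coord ord0 x).
rewrite -[tr D y]/(alpha * diag_coord ord0 y).
rewrite -[tr D _]/(alpha * diag_coord ord0 (x * y)).
by rewrite diag_coordM mulrACA -mulrA.
Qed.

Lemma diag_unit2_subproof : diag_mx (delta_mx 0 ord_max) \in @diag_pred F.
Proof. exact: diag_mx_is_diag. Qed.

(** The idempotent (0, 1), on which the trace vanishes. *)
Definition diag_unit2 : D2 F := MkD2 diag_unit2_subproof.

Lemma diag_coord_unit2 i : diag_coord i diag_unit2 = (i == ord_max)%:R.
Proof. by rewrite /diag_coord /= !mxE !eqxx. Qed.

Lemma var_D2_mulC (A : trAlg F) : var_tr D A -> forall x y : A, x * y = y * x.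
Proof.
by move=> /(_ _ ((commutator_identityP D).2 diag_mulC))/commutator_identityP.
Qed.

Lemma var_D2_trM (A : trAlg F) : var_tr D A ->
  forall x y : A, tr A x * tr A y = alpha * tr A (x * y).
Proof.
by move=> /(_ _ ((tr_mul_identityP alpha D).2 diag_trM))/tr_mul_identityP.
Qed.

End Diagonal.

(** ** Evaluation when the trace is proportional to a multiplicative form *)

Section TraceCharacter.
Variables (F : fieldType) (alpha : F) (A : trAlg F).
Hypothesis alpha0 : alpha != 0.
Hypothesis trM : forall x y : A, tr A x * tr A y = alpha * tr A (x * y).

Lemma tr_prod (phi : nat -> A) (u : nword) :
  tr A (\prod_(i <- val u) phi i)
  = alpha * \prod_(i <- val u) (alpha^-1 * tr A (phi i)).
Proof.
case: u => -[//|i s] _ /=; elim: s i => [|j s IHs] i.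
  by rewrite !big_seq1 mulVKf.
rewrite big_cons [in RHS]big_cons mulrCA -IHs.
by rewrite -mulrA trM mulKf.
Qed.

Lemma eval_tr_mon_char (phi : nat -> A) us w :
  eval_tr phi (tr_mon F us w) =
  (alpha ^+ size us *
     \prod_(i <- flatten [seq val u | u <- us]) (alpha^-1 * tr A (phi i)))
    *: \prod_(i <- w) phi i.
Proof.
rewrite eval_tr_mon; congr (_ *: _); elim: us => [|u us IHus] /=.
  by rewrite !big_nil mulr1.
by rewrite big_cons IHus big_cat /= tr_prod exprS mulrACA.
Qed.

End TraceCharacter.

(** * Exponential growth *)

Section Exponential.
Variables (F : fieldType) (alpha : F).
Hypothesis alpha0 : alpha != 0.
Local Notation D := (D2_tr alpha).

(** The substitutions [phi] below are dual, up to nonzero scalars, to the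
monomials Tr(x_S) x_(~S). *)
Lemma leq_codim_D2 n : (2 ^ n <= codim D n)%N.
Proof.
rewrite -[X in (2 ^ X)%N]card_ord -cardsT -card_powerset powersetT cardsT.
pose vals (S : {pred 'I_n}) := [seq val i | i <- filter S (enum 'I_n)].
(* The trace part has one trace if S is nonempty and none otherwise: [insub]
   discards the empty word. *)
pose us (S : {set 'I_n}) : seq nword := pmap insub [:: vals (mem S)].
pose rest (S : {set 'I_n}) := vals (predC (mem S)).
have usE S : flatten [seq val u | u <- us S] = vals (mem S).
  rewrite /us /=; case: insubP => [u _ /= ->|/=]; first by rewrite cats0.
  by case: (vals _).
apply: (@leq_codim _ _ _ _ (fun S => tr_mon F (us S) (rest S))) => [S|a aI S0].
  exists 1, (fun=> 1), (fun=> tr_mon F (us S) (rest S)).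
  rewrite big_ord1 scale1r; split=> // _; exists (us S), (rest S); split=> //.
  rewrite usE -val_enum_ord -map_cat perm_map //.
  by rewrite perm_filterC.
pose e := diag_unit2 F.
pose phi i : D := if i \in vals (mem S0) then 1 - e else e.
have valsE S i : (val i \in vals S) = S i.
  by rewrite (mem_map val_inj) mem_filter mem_enum andbT.
have phiE (i : 'I_n) : phi i = if i \in S0 then 1 - e else e.
  by rewrite /phi valsE.
have trphi (i : 'I_n) : alpha^-1 * tr D (phi i) = (i \in S0)%:R.
  rewrite -[tr D _]/(alpha * diag_coord ord0 _) mulKf // phiE /e.
  by case: ifP => _; rewrite ?diag_coordB ?diag_coord1 diag_coord_unit2 ?subr0.
have cphi (i : 'I_n) : diag_coord ord_max (phi i) = (i \notin S0)%:R.
  rewrite phiE /e.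
  by case: ifP => _; rewrite ?diag_coordB ?diag_coord1 diag_coord_unit2 ?subrr.
have valsP (S : {pred 'I_n}) (f : nat -> F) :
    \prod_(i <- vals S) f i = \prod_(i | S i) f i.
  by rewrite big_map big_filter big_enum_cond.
have gE S : diag_coord ord_max (eval_tr phi (tr_mon F (us S) (rest S))) =
    alpha ^+ size (us S) * (S == S0)%:R.
  rewrite (eval_tr_mon_char alpha0 (@diag_trM _ _)) diag_coordZ diag_coord_prod.
  rewrite usE !valsP -mulrA; congr (_ * _).
  transitivity (\prod_(i in S) (i \in S0)%:R
                * \prod_(i | i \notin S) (i \notin S0)%:R : F).
    by congr (_ * _); apply: eq_bigr => i _; rewrite ?trphi ?cphi.
  have [->|nSS] := eqVneq S S0.
    by rewrite !big1 ?mulr1 // => i ->.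
  have [i iSS] : exists i, (i \in S) != (i \in S0).
    apply/existsP; apply: contraNT nSS; rewrite negb_exists => /forallP SS.
    by apply/eqP/setP => i; apply/eqP; have := SS i; rewrite negbK.
  have [iS|iS] := boolP (i \in S).
    have /negbTE iS0 : i \notin S0 by move: iSS; rewrite iS; case: (i \in S0).
    by rewrite (bigD1 i) //= iS0 !mul0r.
  have iS0 : i \in S0 by move: iSS; rewrite (negbTE iS); case: (i \in S0).
  by rewrite [X in _ * X](bigD1 i) //= iS0 mul0r mulr0.
have /(congr1 (diag_coord ord_max)) := aI phi; rewrite eval_tr_sum.
have c0 : diag_coord ord_max (0 : D2 F) = 0 by rewrite /diag_coord /= mxE.
rewrite (big_morph _ (diag_coordD ord_max) c0) c0 (bigD1 S0) //= big1.
  rewrite diag_coordZ gE eqxx mulr1 addr0 => /eqP.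
  by rewrite mulf_eq0 expf_eq0 (negbTE alpha0) andbF orbF => /eqP.
by move=> S nS; rewrite diag_coordZ gE (negbTE nS) !mulr0.
Qed.

End Exponential.

(** * Nil of bounded index implies nilpotent *)

Section NilToNilpotent.
Variables (F : fieldType) (A : algType F) (N : A -> Prop) (k : nat).
Hypothesis charF0 : [pchar F] =i pred0.
Hypothesis mulC : forall x y : A, x * y = y * x.
Hypothesis N0 : N 0.
Hypothesis N_lin : forall a x y, N x -> N y -> N (x + a *: y).
Hypothesis N_nil : forall x, N x -> x ^+ k = 0.

(** Partial polarizations of x^k = 0. Each step replaces x by x + l y and takes
the coefficient of l, which is a nonzero integer times the next one. *)
Lemma nil_polarization (s : seq A) (x : A) :
    {in s, forall y, N y} -> N x -> (size s <= k)%N ->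
  x ^+ (k - size s) * \prod_(y <- s) y = 0.
Proof.
elim: s x => [|y s IHs] x sN Nx /= le_sk.
  by rewrite big_nil subn0 N_nil ?mul0r.
have Ny : N y by apply: sN; rewrite mem_head.
have sN' : {in s, forall z, N z} by move=> z zs; apply: sN; rewrite inE zs orbT.
have := IHs _ sN' _ (ltnW le_sk); rewrite -(subnSK le_sk) big_cons.
set m := (k - _)%N; set p := \prod_(z <- s) z => IH.
(* The coefficient of [l ^+ i] in [(x + l *: y) ^+ m.+1 * p]. *)
pose w i := (x ^+ (m.+1 - i) * y ^+ i * p) *+ 'C(m.+1, i).
have w0 (l : F) : \sum_(i < m.+2) l ^+ i *: w i = 0.
  rewrite -[RHS](IH _ (N_lin l Nx Ny)) exprDn_comm; last exact: mulC.
  rewrite mulr_suml; apply: eq_bigr => i _; rewrite /w exprZn.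
  by rewrite -scalerAr mulrnAl -scalerAl scalerMnr.
have := poly_vanish_coef charF0 w0 (isT : (1 < m.+2)%N).
rewrite /w subSS subn0 expr1 bin1 -scaler_nat => /eqP.
by rewrite scaler_eq0 ((pcharf0P F).1 charF0) /= mulrA => /eqP.
Qed.

Lemma nil_prod_eq0 (s : seq A) :
  {in s, forall y, N y} -> (k <= size s)%N -> \prod_(y <- s) y = 0.
Proof.
move=> sN le_ks; rewrite -(cat_take_drop k s) big_cat /=.
have sz : size (take k s) = k by apply: size_takel.
have /nil_polarization/(_ N0) : {in take k s, forall y, N y}.
  by move=> y /mem_take/sN.
by rewrite sz subnn mul1r => -> //; rewrite mul0r.
Qed.

End NilToNilpotent.

(** * The polynomial model *)

Lemma horner_algZ (F : fieldType) (A : algType F) (x : A) :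
  scalable (horner_alg x).
Proof. by move=> a p; rewrite linearZ /= mulr_algl. Qed.

Lemma horner_alg_affine (F : fieldType) (A : algType F) (x : A) (u v : F) :
  horner_alg x (u%:P + v *: 'X) = u%:A + v *: x.
Proof. by rewrite rmorphD /= horner_algC horner_algZ horner_algX. Qed.

Section PolynomialModel.
Variables (F : fieldType) (alpha : F).

Definition poly_trace (p : {poly F}) : F := alpha * p.[0].

Lemma poly_trace_linear : scalar poly_trace.
Proof. by move=> a p q; rewrite /poly_trace hornerD hornerZ mulrDr mulrCA. Qed.

HB.instance Definition _ := GRing.isLinear.Build F {poly F} F *%R poly_trace
  poly_trace_linear.

Lemma poly_traceC (p q : {poly F}) : poly_trace (p * q) = poly_trace (q * p).
Proof. by rewrite mulrC. Qed.

Definition poly_trAlg : trAlg F := @TrAlg F {poly F} poly_trace poly_traceC.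

Hypothesis alpha0 : alpha != 0.

Section Specialization.
Variables (A : trAlg F) (x : A).
Hypothesis trM : forall x y : A, tr A x * tr A y = alpha * tr A (x * y).
Hypothesis tr1 : tr A 1 = alpha.
Hypothesis trx0 : tr A x = 0.

(** Multiplicativity makes the kernel of the trace an ideal, so that only the
constant term of [p] contributes. *)
Lemma tr_horner_alg (p : {poly F}) : tr A (horner_alg x p) = alpha * p.[0].
Proof.
elim/poly_ind: p => [|p c _]; first by rewrite !raddf0 horner0 mulr0.
rewrite rmorphD rmorphM /= horner_algX horner_algC hornerMXaddC mulr0 add0r.
rewrite linearD linearZ /= tr1 [tr A (_ * x)](_ : _ = 0) ?add0r 1?mulrC //.
by apply: (mulfI alpha0); rewrite -trM trx0 !mulr0.
Qed.

Lemma eval_tr_horner_alg (phi : nat -> {poly F}) (f : freeTr F) :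
  eval_tr (fun i => horner_alg x (phi i)) f
  = horner_alg x (eval_tr (phi : nat -> poly_trAlg) f).
Proof.
exact: (@eval_tr_morph F poly_trAlg A (horner_alg x) phi f (horner_algZ x)
                       tr_horner_alg).
Qed.

End Specialization.

(** Every element (u, v) of the diagonal algebra is the image of
u + (v - u) T under T |-> (0, 1), so its substitutions factor through
polynomials. *)
Lemma not_identity_D2_poly (f : freeTr F) :
  ~ tr_identity (D2_tr alpha) f -> ~ tr_identity poly_trAlg f.
Proof.
move=> nf fp; apply: nf => phi; pose e := diag_unit2 F : D2_tr alpha.
have tr1 : tr (D2_tr alpha) 1 = alpha.
  by rewrite -[LHS]/(alpha * diag_coord ord0 1) diag_coord1 mulr1.
have tre : tr (D2_tr alpha) e = 0.
  by rewrite -[LHS]/(alpha * diag_coord ord0 _) diag_coord_unit2 mulr0.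
pose u i := diag_coord ord0 (phi i); pose v i := diag_coord ord_max (phi i).
have -> : phi = fun i => horner_alg e ((u i)%:P + (v i - u i) *: 'X).
  apply/funext => i; rewrite horner_alg_affine /e.
  apply: diag_coord_inj => j.
  rewrite diag_coordD !diag_coordZ diag_coord1 diag_coord_unit2 mulr1.
  case: j => -[|[|//]] lt_j /=.
    by rewrite mulr0 addr0; congr diag_coord; apply: val_inj.
  by rewrite mulr1 addrC subrK; congr diag_coord; apply: val_inj.
by rewrite (eval_tr_horner_alg (@diag_trM _ _) tr1 tre) fp raddf0.
Qed.

(** A nonzero value [q] of [f] in the polynomial model specializes to 0 at
every [l *: x] with [x] of trace 0; the coefficients in [l] vanish separately,
and the leading one gives [x ^+ (size q).-1 = 0]. *)
Lemma nil_index (A : trAlg F) (f : freeTr F) :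
    [pchar F] =i pred0 ->
    (forall x y : A, tr A x * tr A y = alpha * tr A (x * y)) ->
    tr A 1 = alpha ->
    tr_identity A f -> ~ tr_identity (D2_tr alpha) f ->
  exists k, forall x : A, tr A x = 0 -> x ^+ k = 0.
Proof.
move=> charF0 trM tr1 fA /not_identity_D2_poly/existsNP[phi /eqP].
pose q : {poly F} := eval_tr phi f; rewrite -[eval_tr _ _]/q => q0.
exists (size q).-1 => x trx.
have sq : ((size q).-1 < size q)%N by rewrite prednK // size_poly_gt0.
have q_x (l : F) : \sum_(i < size q) l ^+ i *: (q`_i *: x ^+ i) = 0.
  have trlx : tr A (l *: x) = 0 by rewrite linearZ /= trx mulr0.
  rewrite -[RHS](fA (fun i => horner_alg (l *: x) (phi i))).
  rewrite (eval_tr_horner_alg trM tr1 trlx) -/q -[q in RHS]coefK poly_def.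
  rewrite raddf_sum; apply: eq_bigr => i _ /=.
  by rewrite horner_algZ rmorphXn /= horner_algX exprZn !scalerA mulrC.
have /eqP := @poly_vanish_coef _ _ _ (fun i => q`_i *: x ^+ i) charF0 q_x _ sq.
by rewrite scaler_eq0 -lead_coefE lead_coef_eq0 (negbTE q0) => /eqP.
Qed.

End PolynomialModel.

(** * Polynomial growth of the proper subvarieties *)

Section Products.
Variables (F : fieldType) (A : algType F).

Lemma prod_eq0_mem (I : eqType) (s : seq I) (f : I -> A) (i : I) :
  i \in s -> f i = 0 -> \prod_(j <- s) f j = 0.
Proof.
by case/splitPr=> s1 s2 fi0; rewrite big_cat big_cons fi0 /= mul0r mulr0.
Qed.

Lemma prod_pull_scalars (I : Type) (s : seq I) (P : pred I) (y : I -> A)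
    (c : I -> F) :
  \prod_(i <- s) (if P i then y i else (c i)%:A)
  = (\prod_(i <- s | ~~ P i) c i) *: \prod_(i <- s | P i) y i.
Proof.
elim: s => [|i s IHs]; first by rewrite !big_nil scale1r.
rewrite !big_cons IHs; case: (P i) => /=; first by rewrite -scalerAr.
by rewrite mulr_algl scalerA.
Qed.

(** Commutativity is a hypothesis on an arbitrary algebra here, so the
commutative monoid law that big operators require is built locally. *)
Lemma prod_perm_eq (I : eqType) (s t : seq I) (f : I -> A) :
    (forall x y : A, x * y = y * x) -> perm_eq s t ->
  \prod_(i <- s) f i = \prod_(i <- t) f i.
Proof.
move=> mulC st.
pose cmul : Monoid.com_law (1 : A) := HB.pack_for (Monoid.com_law (1 : A))
  ( *%R : A -> A -> A)
  (Monoid.isComLaw.Build A 1 *%R (@mulrA A) mulC (@mul1r A)).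
exact: (perm_big (op := cmul)).
Qed.

End Products.

Section PolynomialGrowth.

Lemma leq_bin_exp n j : ('C(n, j) <= n ^ j)%N.
Proof.
apply: (@leq_trans (n ^_ j)).
  by rewrite -bin_ffact leq_pmulr // fact_gt0.
elim: j => [|j IHj]; first by rewrite ffactn0.
by rewrite ffactnSr expnSr leq_mul // leq_subr.
Qed.

Lemma card_small_sets n k :
  (#|[set S : {set 'I_n} | (#|S| < k)%N]| <= \sum_(j < k) n ^ j)%N.
Proof.
elim: k => [|k IHk].
  by rewrite big_ord0 leqn0 cards_eq0; apply/eqP/setP => S; rewrite !inE.
rewrite big_ord_recr /=; apply: leq_trans (leq_add IHk (leq_bin_exp n k)).
rewrite -[X in 'C(X, _)]card_ord -card_draws.
apply: leq_trans (leq_card_setU _ _); apply: subset_leq_card.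
by apply/fintype.subsetP => S; rewrite !inE ltnS leq_eqVlt orbC.
Qed.

Variables (F : fieldType) (alpha : F) (A : trAlg F).
Hypothesis mulC : forall x y : A, x * y = y * x.

Lemma codim_tr0 n : (forall x, tr A x = 0) -> (codim A n <= 1)%N.
Proof.
move=> tr0; rewrite -card_unit.
apply: (codim_leq (h := fun _ phi => \prod_(i <- iota 0 n) phi i)) => us w Pw.
exists (fun=> (us == [::])%:R) => phi.
rewrite big_const cardT enumT unlock /= addr0.
rewrite eval_tr_mon; case: us Pw => [|u us] Pw.
  by rewrite big_nil !scale1r; apply: prod_perm_eq.
by rewrite big_cons tr0 mul0r !scale0r.
Qed.

Hypothesis alpha0 : alpha != 0.
Hypothesis trM : forall x y : A, tr A x * tr A y = alpha * tr A (x * y).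
Hypothesis tr1 : tr A 1 = alpha.
Variable k : nat.
Hypothesis ker_nil : forall s : seq A,
  {in s, forall y, tr A y = 0} -> (k <= size s)%N -> \prod_(y <- s) y = 0.

Let chi (x : A) : F := alpha^-1 * tr A x.

(** The analogue of a proper polynomial: the variables in [S] enter through
their components in the kernel of [chi], the others through their scalar
components. *)
Definition proper_mon n (S : {set 'I_n}) (phi : nat -> A) : A :=
  \prod_(i < n)
    (if i \in S then phi i - (chi (phi i))%:A else (chi (phi i))%:A).

Lemma proper_mon_eq0 n (S : {set 'I_n}) phi :
  (k <= #|S|)%N -> proper_mon S phi = 0.
Proof.
move=> le_kS; rewrite /proper_mon prod_pull_scalars.
pose nu (i : 'I_n) := phi i - (chi (phi i))%:A.
have -> : \prod_(i in S) (phi i - (chi (phi i))%:A)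
    = \prod_(y <- [seq nu i | i <- index_enum 'I_n & i \in S]) y.
  by rewrite big_map big_filter.
rewrite ker_nil ?scaler0 //; last first.
  by rewrite size_map size_filter -sum1_count sum1_card.
move=> _ /mapP[i _ ->].
by rewrite linearB linearZ /= tr1 /chi mulrAC mulVf // mul1r subrr.
Qed.

(** Expansion of the product after splitting each variable of the word [w] as
the sum of its scalar and kernel components; the variables under traces only
have a scalar component, which excludes the [S] not contained in [w]. *)
Lemma mon_expand n us w phi :
    perm_eq (flatten [seq val u | u <- us] ++ w) (iota 0 n) ->
  eval_tr phi (tr_mon F us w) = alpha ^+ size us *:
    \sum_(S : {set 'I_n}) [forall i in S, val i \in w]%:R *: proper_mon S phi.
Proof.
move=> Pw; rewrite (eval_tr_mon_char alpha0 trM) -scalerA; congr (_ *: _).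
pose psi i := if i \in w then phi i else (chi (phi i))%:A.
have : uniq (flatten [seq val u | u <- us] ++ w).
  by rewrite (perm_uniq Pw) iota_uniq.
rewrite cat_uniq => /and3P[_ /hasPn fl_w _].
transitivity (\prod_(i < n) psi i).
  rewrite -mulr_algl -[X in X * _]/(in_alg A _) rmorph_prod.
  rewrite -(big_mkord predT psi) /index_iota subn0.
  rewrite -(prod_perm_eq psi mulC Pw) big_cat.
  congr (_ * _); apply: eq_big_seq => i i_s; rewrite /psi ?i_s //.
  by rewrite ifN //; apply: contraTN i_s => /fl_w.
have psiE (i : 'I_n) : psi i =
    (if val i \in w then phi i - (chi (phi i))%:A else 0) + (chi (phi i))%:A.
  by rewrite /psi; case: ifP => _; rewrite ?subrK ?add0r.
under eq_bigr do rewrite psiE; rewrite bigA_distr; apply: eq_bigr => S _.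
have [/forall_inP Sw|] := boolP [forall i in S, val i \in w].
  rewrite scale1r /proper_mon /=; apply: eq_bigr => i _.
  by case: ifP => // /Sw ->.
rewrite negb_forall_in => /exists_inP[i iS iw]; rewrite scale0r.
apply: (@prod_eq0_mem _ _ _ _ _ i); rewrite ?mem_index_enum //.
by rewrite iS (negbTE iw).
Qed.

Lemma codim_leq_small_sets n :
  (codim A n <= #|[set S : {set 'I_n} | (#|S| < k)%N]|)%N.
Proof.
apply: (codim_leq (h := @proper_mon n)) => us w Pw.
exists (fun S : {set 'I_n} =>
  alpha ^+ size us * [forall i in S, val i \in w]%:R) => phi.
rewrite (mon_expand _ Pw) scaler_sumr.
rewrite (bigID (mem [set S : {set 'I_n} | (#|S| < k)%N])) /=.
rewrite [X in _ + X]big1 ?addr0.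
  by apply: eq_bigr => S _; rewrite scalerA.
by move=> S; rewrite inE -leqNgt => /(proper_mon_eq0 phi)->; rewrite !scaler0.
Qed.

End PolynomialGrowth.

Theorem theorem13 (R : realType) (F : fieldType)
    (charF0 : [pchar F]%R =i pred0) (alpha : F) (alpha_neq0 : alpha != 0) :
  almost_polynomial_growth R (var_tr (D2_tr alpha)).
Proof.
split=> [A AD|A [AD [B [BD nAB]]] A' A'A].
  exists 1, 2; rewrite ltr01 ltr1n; split=> // n _; rewrite mul1r.
  have <- : codim (D2_tr alpha) n = codim A n.
    have idE : tr_identity (D2_tr alpha) = tr_identity A.
      apply/seteqP; split; first by apply/AD.
      by apply/AD.
    by apply: codim_uniq; rewrite idE; apply: codimP.
  by rewrite -natrX ler_nat leq_codim_D2.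
have A'D : var_tr (D2_tr alpha) A' by apply: AD; apply/A'A.
have mulC := var_D2_mulC A'D; have trM := var_D2_trM A'D.
have [t1|t1] := eqVneq (tr A' 1) alpha; last first.
  have tr0 x : tr A' x = 0.
    have := trM x 1; rewrite mulr1 mulrC => /eqP.
    by rewrite -subr_eq0 -mulrBl mulf_eq0 subr_eq0 (negbTE t1) => /eqP.
  by exists 1 => n _; rewrite hornerC lern1 codim_tr0.
(* If every identity of [A] held in [D2_tr alpha], then [var_tr A] would
   contain the whole variety, and in particular [B]. *)
have [f [fA nf]] : exists f, tr_identity A f /\ ~ tr_identity (D2_tr alpha) f.
  apply: contrapT => nfA; apply: nAB => f fA; apply: BD.
  by apply: contrapT => nf; apply: nfA; exists f.
have fA' : tr_identity A' f by apply: ((A'A A').2 _ _ fA).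
have [k nilk] := nil_index alpha_neq0 charF0 trM t1 fA' nf.
have ker_nil s : {in s, forall y, tr A' y = 0} -> (k <= size s)%N ->
    \prod_(y <- s) y = 0.
  apply: (nil_prod_eq0 charF0 mulC _ _ nilk); first by rewrite linear0.
  by move=> a x y x0 y0; rewrite linearD linearZ /= x0 y0 mulr0 addr0.
exists (\sum_(j < k) 'X^j) => n _.
apply: (@Order.POrderTheory.le_trans _ _ (\sum_(j < k) n ^ j)%:R).
  rewrite ler_nat; apply: leq_trans (card_small_sets n k).
  exact: (codim_leq_small_sets mulC alpha_neq0 trM t1 ker_nil).
rewrite horner_sum natr_sum; apply: ler_sum => j _.
by rewrite hornerXn natrX.
Qed.
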